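(* For every integer $m\ge 1$, the adjacency matrix $\mathcal T^*_m$ of the digraph $\mathcal D^*_m$ is a symmetric binary (i.e. $0/1$) matrix: $\mathcal T^*_m=(\mathcal T^*_m)^{T}$.
   Context: Digraph $\mathcal D_m$: let $\mathcal D_{ud}$ be the digraph on $\{a,b,c,d,e,f\}$ with arcs from each of $a,b,d$ to each of $b,c,f$, and from each of $c,e,f$ to each of $a,d,e$; let $\mathcal D_{lr}$ be the digraph on the same letters with arcs from each of $a,c,e$ to each of $d,e,f$, and from each of $b,d,f$ to each of $a,b,c$. $V(\mathcal D_m)$ is the set of words $\alpha_1\cdots\alpha_m$ over $\{a,b,c,d,e,f\}$ with $\alpha_1\in\{a,d,e\}$, $\alpha_m\in\{c,e,f\}$ and each $(\alpha_i,\alpha_{i+1})$, $1\le i\le m-1$, an arc of $\mathcal D_{ud}$. There is an arc $\alpha_1\cdots\alpha_m\to\beta_1\cdots\beta_m$ in $\mathcal D_m$ iff every $(\alpha_i,\beta_i)$ is an arc of $\mathcal D_{lr}$. Digraph $\mathcal D^*_m$: the outlet word of $\alpha=\alpha_1\cdots\alpha_m\in V(\mathcal D_m)$ is the binary word $o(\alpha)=o_1\cdots o_m$ with $o_j=0$ if $\alpha_j\in\{b,d,f\}$ and $o_j=1$ if $\alpha_j\in\{a,c,e\}$. Vertices of $\mathcal D_m$ with the same outlet word have the same direct successors. $\mathcal D^*_m$ is obtained from $\mathcal D_m$ by contracting all vertices with the same outlet word $v$ to one vertex labeled $v$, where arcs of $\mathcal D_m$ from the contracted vertices to a common vertex of $\mathcal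 D_m$ are replaced by a single arc. (Two different vertices of $\mathcal D_m$ with the same outlet word never have a common direct predecessor, so there are no multiple arcs.) Thus $V(\mathcal D^*_m)=\{o(\alpha):\alpha\in V(\mathcal D_m)\}$, and $v\to w$ in $\mathcal D^*_m$ iff there are $x,y\in V(\mathcal D_m)$ with $x\to y$, $o(x)=v$, $o(y)=w$ (loops allowed). *)

(* Defs.v *)
From HB Require Import structures.
From mathcomp Require Import all_boot all_order all_algebra.

Set Implicit Arguments.
Unset Strict Implicit.
Unset Printing Implicit Defensive.

Inductive letter : predArgType := La | Lb | Lc | Ld | Le | Lf.

Definition ord_of_letter (x : letter) : 'I_6 :=
  match x with
  | La => @Ordinal 6 0 isT | Lb => @Ordinal 6 1 isT | Lc => @Ordinal 6 2 isT
  | Ld => @Ordinal 6 3 isT | Le => @Ordinal 6 4 isT | Lf => @Ordinal 6 5 isT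
  end.

Definition letter_of_ord (i : 'I_6) : letter :=
  nth La [:: La; Lb; Lc; Ld; Le; Lf] i.

Lemma ord_of_letterK : cancel ord_of_letter letter_of_ord.
Proof. by case. Qed.

HB.instance Definition _ := Finite.copy letter (can_type ord_of_letterK).

Definition D_ud : rel letter := fun x y =>
     (x \in [:: La; Lb; Ld]) && (y \in [:: Lb; Lc; Lf])
  || (x \in [:: Lc; Le; Lf]) && (y \in [:: La; Ld; Le]).

Definition D_lr : rel letter := fun x y =>
     (x \in [:: La; Lc; Le]) && (y \in [:: Ld; Le; Lf])
  || (x \in [:: Lb; Ld; Lf]) && (y \in [:: La; Lb; Lc]).

(* The empty word is rejected; only words of length m >= 1 matter. *)
Definition alpha_word (s : seq letter) : bool :=
  if s is x :: s' then
    [&& x \in [:: La; Ld; Le], last x s' \in [:: Lc; Le; Lf] & path D_ud x s']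
  else false.

Definition D_vertices (m : nat) : {set m.-tuple letter} :=
  [set x : m.-tuple letter | alpha_word x].

Definition D_arc (m : nat) : rel (m.-tuple letter) := fun x y =>
  [forall i, D_lr (tnth x i) (tnth y i)].

Definition outlet_letter (x : letter) : bool := x \in [:: La; Lc; Le].

Definition outlet (m : nat) (x : m.-tuple letter) : m.-tuple bool :=
  [tuple of map outlet_letter x].

Definition Dstar_vertices (m : nat) : {set m.-tuple bool} :=
  [set outlet x | x in D_vertices m].

(* Contraction merges two arcs of D_m only when they start in the same outlet
   class and end in the same vertex of D_m.  The arcs v -> w that remain are
   thus in bijection with the vertices y of outlet word w that have a direct
   predecessor of outlet word v; a priori there may be several of them. *)
Definition Dstar_arcs (m : nat) (v w : m.-tuple bool) : {set m.-tuple letter} :=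
  [set y in D_vertices m |
    (outlet y == w) &&
    [exists x in D_vertices m, (outlet x == v) && D_arc x y]].

Definition Dstar_arc (m : nat) : rel (m.-tuple bool) := fun v w =>
  [exists x in D_vertices m, exists y in D_vertices m,
    [&& D_arc x y, outlet x == v & outlet y == w]].

Lemma Dstar_arcs_gt0 (m : nat) (v w : m.-tuple bool) :
  (0 < #|Dstar_arcs v w|) = Dstar_arc v w.
Proof.
apply/card_gt0P/'exists_in_'exists_in_and3P.
  move=> [y]; rewrite inE => /and3P[Vy /eqP yw /'exists_in_andP[x Vx [/eqP xv xy]]].
  by exists x => //; exists y; rewrite // xv yw !eqxx; split.
move=> [x Vx [y Vy [xy xv yw]]]; exists y; rewrite inE Vy yw /=.
by apply/'exists_in_andP; exists x.
Qed.

Definition Tstar (m : nat) : 'M[int]_#|Dstar_vertices m| :=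
  \matrix_(i, j) #|Dstar_arcs (enum_val i) (enum_val j)|%:Z%R.

(* Main.v *)
Require Import Defs.
From mathcomp Require Import all_boot all_order all_algebra.

Set Implicit Arguments.
Unset Strict Implicit.

(** The six letters are the ways in which a cell of a column can be joined to
    exactly two of its four neighbours: a joins right and down, b up and down,
    c up and right, d left and down, e left and right, f left and up.  [D_ud]
    and [D_lr] say that two adjacent cells agree on their common side, and a
    vertex of D_m is a column of cells with no join across its top or bottom
    border.  Call the word of left joins of a column y its inlet word; then
    x -> y in D_m means that the outlet word of x is the inlet word of y.

    Entries are 0 or 1: going down a column, the cell above determines whether
    the current cell is joined upwards, and a cell is determined by its up,
    left and right joins.  A column is thus determined by its inlet and outlet
    words ([Dstar_arcs_le1]).

    Symmetry: exchanging left and right maps columns to columns and swaps the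
    inlet and outlet words.  If x -> y witnesses an arc v -> w, then y is
    followed by its own mirror image, whose outlet word is the inlet word v of
    y; this is an arc w -> v ([Dstar_arc_sym]). *)

Definition inlet_letter (x : letter) : bool := x \in [:: Ld; Le; Lf].

Definition mirror_letter (x : letter) : letter :=
  match x with
  | La => Ld | Lb => Lb | Lc => Lf | Ld => La | Le => Le | Lf => Lc
  end.

Lemma D_lrE (x y : letter) : D_lr x y = (inlet_letter y == outlet_letter x).
Proof. by case: x; case: y. Qed.

Lemma outlet_mirror_letter (x : letter) :
  outlet_letter (mirror_letter x) = inlet_letter x.
Proof. by case: x. Qed.

Lemma inlet_mirror_letter (x : letter) :
  inlet_letter (mirror_letter x) = outlet_letter x.
Proof. by case: x. Qed.

Lemma D_ud_mirror (x y : letter) :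
  D_ud (mirror_letter x) (mirror_letter y) = D_ud x y.
Proof. by case: x; case: y. Qed.

(** The letter above only serves to fix the up join shared by y and z. *)
Lemma D_ud_inj (x y z : letter) :
  D_ud x y -> D_ud x z ->
  inlet_letter y = inlet_letter z -> outlet_letter y = outlet_letter z -> y = z.
Proof. by case: x; case: y; case: z. Qed.

Lemma path_D_ud_inj (x : letter) (s t : seq letter) :
  path D_ud x s -> path D_ud x t ->
  map inlet_letter s = map inlet_letter t ->
  map outlet_letter s = map outlet_letter t -> s = t.
Proof.
elim: s x t => [|y s IHs] x [|z t] //= /andP[xy ys] /andP[xz zt].
move=> [in_yz in_st] [out_yz out_st].
have eq_yz := D_ud_inj xy xz in_yz out_yz.
by rewrite -eq_yz in zt *; rewrite (IHs y t ys zt).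
Qed.

(** The letter e has no down join, so placing it above a word expresses that
    the first letter has no up join. *)
Lemma alpha_word_path (s : seq letter) : alpha_word s -> path D_ud Le s.
Proof. by case: s => //= y s /and3P[y_top _ ->]; rewrite andbT; case: y y_top. Qed.

Lemma alpha_word_mirror (s : seq letter) :
  alpha_word (map mirror_letter s) = alpha_word s.
Proof.
case: s => //= x s; rewrite last_map path_map; congr [&& _, _ & _].
- by case: x.
- by case: (last x s).
- exact/eq_path/D_ud_mirror.
Qed.

Lemma D_arcE (m : nat) (x y : m.-tuple letter) :
  D_arc x y = (map inlet_letter y == outlet x).
Proof.
rewrite -[map _ _]/(tval (map_tuple _ y)) -[RHS]/(_ == _ :> m.-tuple bool).
apply/forallP/eqP => [xy | eq_yx i].
  by apply: eq_from_tnth => i; move: (xy i); rewrite D_lrE !tnth_map => /eqP.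
by have /(congr1 (fun u => tnth u i)) := eq_yx; rewrite D_lrE !tnth_map => ->.
Qed.

Lemma Dstar_arcs_le1 (m : nat) (v w : m.-tuple bool) :
  (#|Dstar_arcs v w| <= 1)%N.
Proof.
apply/card_le1_eqP => y z; rewrite !inE.
move=> /and3P[/alpha_word_path Vy /eqP yw /'exists_in_andP[x _ [/eqP xv]]].
rewrite D_arcE xv => /eqP in_y.
move=> /and3P[/alpha_word_path Vz /eqP zw /'exists_in_andP[x' _ [/eqP x'v]]].
rewrite D_arcE x'v => /eqP in_z.
apply/val_inj/(path_D_ud_inj Vz Vy); first by rewrite in_y.
by rewrite -[LHS]/(val (outlet z)) zw -yw.
Qed.

Lemma card_Dstar_arcs (m : nat) (v w : m.-tuple bool) :
  #|Dstar_arcs v w| = Dstar_arc v w.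
Proof. by rewrite -Dstar_arcs_gt0; case: #|_| (Dstar_arcs_le1 v w) => [|[]]. Qed.

Lemma Dstar_arc_imp_sym (m : nat) (v w : m.-tuple bool) :
  Dstar_arc v w -> Dstar_arc w v.
Proof.
case/'exists_in_'exists_in_and3P => x _ [y Vy [xy /eqP xv /eqP yw]].
apply/'exists_in_'exists_in_and3P; exists y => //.
exists (map_tuple mirror_letter y).
  by move: Vy; rewrite !inE alpha_word_mirror.
split.
- by rewrite D_arcE /= -map_comp (eq_map inlet_mirror_letter).
- exact/eqP.
- rewrite -val_eqE /= -map_comp (eq_map outlet_mirror_letter) -xv.
  by move: xy; rewrite D_arcE.
Qed.

Lemma Dstar_arc_sym (m : nat) : symmetric (@Dstar_arc m).
Proof. by move=> v w; apply/idP/idP; apply: Dstar_arc_imp_sym. Qed.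

Local Open Scope ring_scope.

Theorem theorem3p8 (m : nat) (hm : (1 <= m)%N) :
  (forall i j, Tstar m i j = 0 \/ Tstar m i j = 1) /\
  Tstar m = (Tstar m)^T.
Proof.
split=> [i j|]; last first.
  by apply/matrixP => i j; rewrite !mxE !card_Dstar_arcs Dstar_arc_sym.
by rewrite mxE card_Dstar_arcs; case: Dstar_arc; [right | left].
Qed.
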